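(* Let $Q$ be a Steiner loop, $K$ an abelian group (written additively), and $f:Q\times Q\to K$ a map. Then $(\mathrm{id},f)$ is a C-factor set if and only if for every $u,v\in Q$ with $1\ne u\ne v\ne 1$ there are $a,b,c,d\in K$ such that the restriction of $f$ to $\langle u,v\rangle\times\langle u,v\rangle$ is given by the table (rows: first argument, columns: second argument) $$\begin{array}{c|cccc} f&1&u&v&uv\\ \hline 1&0&0&0&0\\ u&0&a&a+b-c-d&-b+c+d\\ v&0&d&b&b-d\\ uv&0&a-d&-a+c+d&c \end{array}$$
   Context: A Steiner loop is an inverse property loop of exponent two; equivalently, a commutative loop satisfying $x\cdot xy=y$. The condition $1\ne u\ne v\ne 1$ means that $u,v$ are distinct nonidentity elements; in that case the subloop $\langle u,v\rangle$ generated by $u$ and $v$ is $\{1,u,v,uv\}$, isomorphic to the Klein group. For a map $f:Q\times Q\to K$, the pair $(\mathrm{id},f)$ (where $\mathrm{id}$ denotes the trivial homomorphism $Q\to\mathrm{Aut}(K)$) is a C-factor set if $f(x,1)=0=f(1,x)$ for all $x\in Q$ and $$f(y,z)+f(y,yz)+f(x,y\cdot yz)=f(x,y)+f(xy,y)+f(xy\cdot y,z)$$ for all $x,y,z\in Q$.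
   Formalization: If Q has no two distinct nonidentity elements (order 1 or 2), f is additionally assumed to satisfy f(x,1)=0=f(1,x), since the table condition is then vacuous and the ''if'' direction fails, e.g. Q={1}, f(1,1)≠0. *)

(* Defs.v *)
From mathcomp Require Import all_boot all_algebra.

Set Implicit Arguments.
Unset Strict Implicit.
Unset Printing Implicit Defensive.

Import GRing.Theory.
Local Open Scope ring_scope.

(* A [umagmaType] is a type with a binary operation [( * )%g] (not assumed to
   be associative) and a two-sided neutral element [1%g]. *)

Definition is_loop (Q : umagmaType) : Prop :=
  (forall a b : Q, exists! x, (a * x = b)%g) /\
  (forall a b : Q, exists! y, (y * a = b)%g).

Definition inverse_property (Q : umagmaType) : Prop :=
  forall x : Q, exists x' : Q, forall y : Q,
    (x' * (x * y) = y)%g /\ ((y * x) * x' = y)%g.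

Definition exponent_two (Q : umagmaType) : Prop := forall x : Q, (x * x = 1)%g.

Definition steiner_loop (Q : umagmaType) : Prop :=
  [/\ is_loop Q, inverse_property Q & exponent_two Q].

(* Closure under products and under both divisions; inside a loop, the
   divisions are determined by the products. *)
Definition subloop (Q : umagmaType) (S : Q -> Prop) : Prop :=
  [/\ S 1%g,
      forall x y, S x -> S y -> S (x * y)%g,
      forall x y, S x -> S (x * y)%g -> S y &
      forall x y, S x -> S (y * x)%g -> S y].

Definition subloop_gen (Q : umagmaType) (u v : Q) : Q -> Prop :=
  fun x => forall S : Q -> Prop, subloop S -> S u -> S v -> S x.

(* The pair (id, f), id being the trivial homomorphism Q -> Aut(K). *)
Definition C_factor_set_id (Q : umagmaType) (K : zmodType) (f : Q -> Q -> K) :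
    Prop :=
  (forall x, f x 1%g = 0 /\ f 1%g x = 0) /\
  (forall x y z : Q,
     f y z + f y (y * z)%g + f x (y * (y * z))%g =
     f x y + f (x * y)%g y + f ((x * y) * y)%g z).

Definition klein_table (K : zmodType) (a b c d : K) : seq (seq K) :=
  [:: [:: 0; 0;     0;             0            ];
      [:: 0; a;     a + b - c - d; - b + c + d  ];
      [:: 0; d;     b;             b - d        ];
      [:: 0; a - d; - a + c + d;   c            ] ].

(* The entry in the row labelled [x] and the column labelled [y], where [h]
   lists the (distinct) labels of the rows, and also of the columns. *)
Definition table_entry (Q : eqType) (K : zmodType) (h : seq Q)
    (T : seq (seq K)) (x y : Q) : K :=
  nth 0 (nth [::] T (index x h)) (index y h).

Lemma steiner_loopP (Q : umagmaType) :
  steiner_loop Q <->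
  [/\ is_loop Q, forall x y : Q, (x * y = y * x)%g &
      forall x y : Q, (x * (x * y) = y)%g].
Proof.
split=> [[lQ ip e2]|[lQ mC mK]]; last first.
  split=> // [x|x]; last by rewrite -{2}(mulg1 x) mK.
  by exists x => y; split; rewrite ?(mC _ x) ?(mC y x) mK.
have mKr (x y : Q) : (x * (x * y) = y)%g /\ ((y * x) * x = y)%g.
  have [x' hx'] := ip x.
  have e : x' = x by case: (hx' x); rewrite e2 mulg1.
  by have := hx' y; rewrite e.
have mK x y := (mKr x y).1; have mKV x y := (mKr x y).2.
split=> // x y.
have e1 : (x * y * y = x)%g by rewrite mKV.
have e3 : (x * y * x = y)%g by rewrite -{2}e1 mK.
by rewrite -{2}e3 mKV.
Qed.

Lemma klein_uniq (Q : umagmaType) (u v : Q) : steiner_loop Q ->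
  1%g != u -> u != v -> v != 1%g -> uniq [:: 1; u; v; u * v]%g.
Proof.
case/steiner_loopP=> _ mC mK u1 uv v1.
have e2 (x : Q) : (x * x = 1)%g by rewrite -{2}(mulg1 x) mK.
rewrite /= !inE !negb_or u1 uv (eq_sym 1%g v) v1 /= andbT.
apply/and3P; split; apply/eqP => e.
- by case/eqP: uv; rewrite -(mulg1 u) e mK.
- by case/eqP: v1; rewrite -(mK u v) -e e2.
- by case/eqP: u1; rewrite -(mK v u) (mC v u) -e e2.
Qed.

Lemma subloop_gen_klein (Q : umagmaType) (u v x : Q) : steiner_loop Q ->
  subloop_gen u v x <-> x \in [:: 1; u; v; u * v]%g.
Proof.
case/steiner_loopP=> _ mC mK.
have e2 (y : Q) : (y * y = 1)%g by rewrite -{2}(mulg1 y) mK.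
split=> [|xin S [S1 SM _ _] Su Sv]; last first.
  by move: xin; rewrite !inE => /or4P[]/eqP-> //; apply: SM.
have M y z : y \in [:: 1; u; v; u * v]%g -> z \in [:: 1; u; v; u * v]%g ->
    (y * z)%g \in [:: 1; u; v; u * v]%g.
  rewrite !inE => /or4P[]/eqP-> /or4P[]/eqP->;
  by rewrite ?mul1g ?mulg1 ?e2 ?mK ?(mC v u) ?(mC (u * v)%g) ?mK
       -?(mC v u) ?mK ?(mC v u) ?eqxx ?orbT.
move=> xin; apply: (xin (fun z => z \in _)); rewrite ?inE ?eqxx ?orbT //.
split=> //; first by rewrite inE eqxx.
- by move=> y z yin yzin; rewrite -(mK y z); apply: M.
- by move=> y z yin; rewrite mC => yzin; rewrite -(mK y z); apply: M.
Qed.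

(* Main.v *)
(* In a Steiner loop [y * (y * z) = z] and [(x * y) * y = x], so the term [f x z]
   cancels from the C-factor set identity. What remains,
     [f y z + f y (y * z) = f x y + f (x * y) y],
   has sides depending on (y, z) and on (x, y) respectively, so both are equal to
   their common value [f y y] at [x = 1]. On the Klein group [{1, u, v, uv}] these
   equations say that the row and the column of [y] away from [1] and [y] sum to
   [f y y], and solving them in terms of the diagonal and of [d = f v u] gives the
   table. *)

Require Import Defs.
From mathcomp Require Import all_boot all_algebra.

Set Implicit Arguments.
Unset Strict Implicit.
Unset Printing Implicit Defensive.

Import GRing.Theory.
Local Open Scope ring_scope.

Lemma C_factor_set_id_steinerP (Q : umagmaType) (K : zmodType)
    (f : Q -> Q -> K) :
  steiner_loop Q ->
  C_factor_set_id f <->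
  [/\ forall x, f x 1%g = 0 /\ f 1%g x = 0,
      forall y z, f y z + f y (y * z)%g = f y y &
      forall x y, f x y + f (x * y)%g y = f y y].
Proof.
case/steiner_loopP=> _ mC mK.
have mKr (x y : Q) : (x * y * y = x)%g by rewrite mC (mC x) mK.
split=> [[f1 fC]|[f1 fl fr]].
  have {}fC x y z : f y z + f y (y * z)%g = f x y + f (x * y)%g y.
    by apply: (addIr (f x z)); have := fC x y z; rewrite mK mKr.
  split=> // [y z|x y].
    by rewrite (fC 1%g) mul1g (f1 y).2 add0r.
  by rewrite -(fC x y 1%g) mulg1 (f1 y).1 add0r.
by split=> // x y z; rewrite mK mKr fl fr.
Qed.

(** The four labels are distinct, so [index] inverts [nth] and the table becomes sixteen
    equations. *)
Lemma klein_table_entryP (Q : umagmaType) (K : zmodType) (f : Q -> Q -> K)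
    (u v : Q) (T : seq (seq K)) (h := [:: 1; u; v; u * v]%g) :
  steiner_loop Q -> 1%g != u -> u != v -> v != 1%g ->
  (forall x y, subloop_gen u v x -> subloop_gen u v y ->
     f x y = table_entry h T x y) <->
  (forall i j, (i < 4)%N -> (j < 4)%N ->
     f (nth 1%g h i) (nth 1%g h j) = nth 0 (nth [::] T i) j).
Proof.
move=> hQ u1 uv v1; have Uh : uniq h := klein_uniq hQ u1 uv v1.
split=> [fT i j lti ltj|fT x y].
  by rewrite fT /table_entry ?index_uniq //; apply/subloop_gen_klein/mem_nth.
move=> /(subloop_gen_klein _ _ _ hQ) xh /(subloop_gen_klein _ _ _ hQ) yh.
by rewrite -{1}(nth_index 1%g xh) -{1}(nth_index 1%g yh) fT // index_mem.
Qed.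

(* The table says nothing when Q has no two distinct nonidentity elements
   (order 1 or 2), whereas C-factor sets are normalized; in that degenerate
   case only, f is assumed to be normalized. *)
Theorem proposition4p1 (Q : umagmaType) (K : zmodType) (f : Q -> Q -> K)
  (hQ : steiner_loop Q)
  (hf : ~ (exists u v : Q, [/\ 1%g != u, u != v & v != 1%g]) ->
        forall x : Q, f x 1%g = 0 /\ f 1%g x = 0) :
  C_factor_set_id f <->
  (forall u v : Q, 1%g != u -> u != v -> v != 1%g ->
     exists a b c d : K, forall x y : Q,
       subloop_gen u v x -> subloop_gen u v y ->
       f x y =
       table_entry [:: 1%g; u; v; (u * v)%g] (klein_table a b c d) x y).
Proof.
have /steiner_loopP[_ mC mK] := hQ.
have e2 (x : Q) : (x * x = 1)%g by rewrite -{2}(mulg1 x) mK.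
apply: (iff_trans (C_factor_set_id_steinerP f hQ)).
split=> [[f1 fl fr] u v u1 uv v1|ftab].
  exists (f u u), (f v v), (f (u * v)%g (u * v)%g), (f v u).
  apply/klein_table_entryP => //.
  (* Equations used, in order: row of [v], column of [u], row of [u * v], column of [v], column of
     [u * v]. *)
  have fvw : f v (u * v)%g = f v v - f v u by rewrite -(fl v u) mC addrC addKr.
  have fwu : f (u * v)%g u = f u u - f v u by rewrite -(fr v u) mC addrC addKr.
  have fwv : f (u * v)%g v = - f u u + f (u * v)%g (u * v)%g + f v u.
    rewrite -(fl (u * v)%g u) fwu (mC _ u) mK.
    by rewrite -(addrA (f u u)) addKr addrAC addNr add0r.
  have fuv : f u v = f u u + f v v - f (u * v)%g (u * v)%g - f v u.
    apply: (addIr (f (u * v)%g v)); rewrite fr fwv.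
    rewrite -(addrA _ (- f (u * v)%g _)) -opprD -(addrA (- f u u)).
    by rewrite (addrC (- f u u)) addrA subrK addrC addKr.
  have fuw : f u (u * v)%g = - f v v + f (u * v)%g (u * v)%g + f v u.
    rewrite -(fr u (u * v)%g) mK fvw.
    by rewrite (addrC (f u _)) -(addrA (f v v)) addKr addrAC addNr add0r.
  have [f11 f1u f1v f1w] :
      [/\ f 1%g 1%g = 0, f 1%g u = 0, f 1%g v = 0 & f 1%g (u * v)%g = 0].
    by split; apply: (f1 _).2.
  by move=> [|[|[|[|//]]]] [|[|[|[|//]]]] _ _ //=; apply: (f1 _).1.
(* The row and column of [u] suffice, as [u] and [v] vary. *)
have tab u v : 1%g != u -> u != v -> v != 1%g ->
    [/\ f u 1%g = 0, f 1%g u = 0, f 1%g 1%g = 0,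
        f u v + f u (u * v)%g = f u u & f v u + f (u * v)%g u = f u u].
  move=> u1 uv v1; have [a [b [c [d]]]] := ftab u v u1 uv v1.
  move=> /(klein_table_entryP _ _ hQ u1 uv v1) fT.
  have := (fT 1 0, fT 0 1, fT 0 0, fT 1 2, fT 1 3, fT 1 1, fT 2 1, fT 3 1)%N.
  do 7!case; do 8!move=> /= -> //.
  split=> //; last by rewrite addrC subrK.
  rewrite -(addrA _ (- c)) -opprD -(addrA (- b)) (addrC (- b)).
  by rewrite addrA subrK addrK.
have f1 x : f x 1%g = 0 /\ f 1%g x = 0.
  suff /andP[/eqP-> /eqP->] : (f x 1%g == 0) && (f 1%g x == 0) by [].
  (* The goal is decidable, so the case distinction on [hf] is constructive. *)
  apply: contraT => fx; case/negP: (fx).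
  have [|-> ->] := hf _ x; last by rewrite eqxx.
  case=> u [v [u1 uv v1]]; case/negP: fx.
  (* A nonidentity [x] is paired with [v] if [x = u], and with [u] otherwise. *)
  have [->|x1] := eqVneq x 1%g.
    by have [_ _ -> _ _] := tab u v u1 uv v1; rewrite eqxx.
  have [xu|xu] := eqVneq x u.
    by rewrite xu; have [-> -> _ _ _] := tab u v u1 uv v1; rewrite eqxx.
  by have [|| -> ->] := tab x u _ xu; rewrite ?eqxx // eq_sym.
split=> // [y z|x y].
  (* Pairs outside the scope of the table follow from normalization. *)
  have [->|y1] := eqVneq y 1%g; first by rewrite !(f1 _).2 addr0.
  have [->|z1] := eqVneq z 1%g; first by rewrite mulg1 (f1 y).1 add0r.
  have [->|yz] := eqVneq y z; first by rewrite e2 (f1 z).1 addr0.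
  by have [|_ _ _ ->] := tab y z _ yz z1; rewrite // eq_sym.
have [->|x1] := eqVneq x 1%g; first by rewrite mul1g (f1 y).2 add0r.
have [->|y1] := eqVneq y 1%g; first by rewrite !(f1 _).1 addr0.
have [->|yx] := eqVneq y x; first by rewrite e2 (f1 x).2 addr0.
by rewrite mC; have [|_ _ _ _ ->] := tab y x _ yx x1; rewrite // eq_sym.
Qed.
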